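(* Let $(\mathscr{C},\mathbb{E},\mathfrak{s})$ be an extriangulated category with enough projective objects and enough injective objects. Suppose that $\mathscr{X}$ is a cluster tilting subcategory of $\mathscr{C}$ and let $\mathcal{A}$ be the abelian quotient category $\mathscr{C}/\mathscr{X}$. Then: (1) The category $\mathcal{A}$ has enough projective objects and enough injective objects. (2) If $\Sigma(\Omega\mathscr{X})\subseteq\mathscr{X}$ and $\Omega(\Sigma\mathscr{X})\subseteq\mathscr{X}$, then the category $\mathcal{A}$ is Gorenstein of Gorenstein dimension at most one.
   Context: Extriangulated categories (Nakaoka–Palu). Let $\mathscr{C}$ be an additive category with a biadditive functor $\mathbb{E}\colon\mathscr{C}^{\mathrm{op}}\times\mathscr{C}\to \mathrm{Ab}$ (abelian groups). An element $\delta\in\mathbb{E}(C,A)$ is called an $\mathbb{E}$-extension; for $a\colon A\to A'$ and $c\colon C'\to C$ write $a_*\delta=\mathbb{E}(C,a)(\delta)\in\mathbb{E}(C,A')$ and $c^*\delta=\mathbb{E}(c,A)(\delta)\in\mathbb{E}(C',A)$. A morphism $\delta\to\delta'$ from $\delta\in\mathbb{E}(C,A)$ to $\delta'\in\mathbb{E}(C',A')$ is a pair $(a,c)$, $a\colon A\to A'$, $c\colon C\to C'$, with $a_*\delta=c^*\delta'$. For $\delta\in\mathbb{E}(C,A)$, $\delta'\in\mathbb{E}(C',A')$, $\delta\oplus\delta'\in\mathbb{E}(C\oplus C',A\oplus A')$ is the element corresponding to $(\delta,0,0,\delta')$ under $\mathbb{E}(C\oplus C',A\oplus A')\cong\mathbb{E}(C,A)\oplus\mathbb{E}(C,A')\oplus\mathbb{E}(C',A)\oplus\mathbb{E}(C',A')$.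 Two sequences $A\to B\to C$ and $A\to B'\to C$ are equivalent if there is an isomorphism $B\to B'$ compatible with the identities of $A$ and $C$; $[A\to B\to C]$ denotes the equivalence class. A realization $\mathfrak{s}$ assigns to each $\delta\in\mathbb{E}(C,A)$ a class $\mathfrak{s}(\delta)=[A\xrightarrow{x}B\xrightarrow{y}C]$ such that, if also $\mathfrak{s}(\delta')=[A'\xrightarrow{x'}B'\xrightarrow{y'}C']$, for every morphism $(a,c)\colon\delta\to\delta'$ there is $b\colon B\to B'$ with $bx=x'a$ and $y'b=cy$. It is additive if $\mathfrak{s}(0)=[A\xrightarrow{\binom{1}{0}}A\oplus C\xrightarrow{(0,1)}C]$ and $\mathfrak{s}(\delta\oplus\delta')=\mathfrak{s}(\delta)\oplus\mathfrak{s}(\delta')$. The triplet $(\mathscr{C},\mathbb{E},\mathfrak{s})$ is an extriangulated category if: (ET1) $\mathbb{E}$ is a biadditive functor. (ET2) $\mathfrak{s}$ is an additive realization of $\mathbb{E}$. (ET3) If $\mathfrak{s}(\delta)=[A\xrightarrow{x}B\xrightarrow{y}C]$, $\mathfrak{s}(\delta')=[A'\xrightarrow{x'}B'\xrightarrow{y'}C']$ and $a\colon A\to A'$, $b\colon B\to B'$ satisfy $bx=x'a$, then there is $c\colon C\to C'$ such that $(a,c)\colon\delta\to\delta'$ is a morphism and $cy=y'b$. (ET3)$^{\mathrm{op}}$: the dual. (ET4) If $A\xrightarrow{f}B\xrightarrow{f'}D$ realizes $\delta\in\mathbb{E}(D,A)$ and $B\xrightarrow{g}C\xrightarrow{g'}F$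 realizes $\delta'\in\mathbb{E}(F,B)$, then there are an object $E$, morphisms $h=gf\colon A\to C$, $h'\colon C\to E$, $d\colon D\to E$, $e\colon E\to F$ with $h'g=df'$, $eh'=g'$, and $\delta''\in\mathbb{E}(E,A)$ realized by $A\xrightarrow{h}C\xrightarrow{h'}E$, such that $D\xrightarrow{d}E\xrightarrow{e}F$ realizes $f'_*\delta'$, $d^*\delta''=\delta$ and $f_*\delta''=e^*\delta'$. (ET4)$^{\mathrm{op}}$: the dual. If $A\xrightarrow{x}B\xrightarrow{y}C$ realizes $\delta$, one writes $A\xrightarrow{x}B\xrightarrow{y}C\overset{\delta}{\dashrightarrow}$ and calls it an $\mathbb{E}$-triangle. An object $P$ is projective if for every $\mathbb{E}$-triangle $A\xrightarrow{x}B\xrightarrow{y}C\dashrightarrow$ every morphism $P\to C$ factors through $y$; injective objects are defined dually. $\mathcal{P}$ and $\mathcal{I}$ denote the full subcategories of projective and injective objects of $\mathscr{C}$. $\mathscr{C}$ has enough projective objects if every $C\in\mathscr{C}$ admits an $\mathbb{E}$-triangle $A\to P\to C\dashrightarrow$ with $P\in\mathcal{P}$; enough injective objects is dual. A (full) subcategory $\mathscr{X}$ of $\mathscr{C}$ is cluster tilting if: (1) $\mathscr{X}$ is functorially finite in $\mathscr{C}$; (2) $M\in\mathscr{X}$ if and only if $\mathbb{E}(M,X)=0$ for all $X\in\mathscr{X}$; (3) $M\in\mathscr{X}$ if and only if $\mathbb{E}(X,M)=0$ for all $X\in\mathscr{X}$. For a subcategory $\mathscr{Y}$ of $\mathscr{C}$,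 $\Omega\mathscr{Y}$ is the full subcategory of all objects $K$ for which there is an $\mathbb{E}$-triangle $K\to P\to Y\dashrightarrow$ with $P\in\mathcal{P}$, $Y\in\mathscr{Y}$; and $\Sigma\mathscr{Y}$ is the full subcategory of all objects $L$ for which there is an $\mathbb{E}$-triangle $Y\to I\to L\dashrightarrow$ with $I\in\mathcal{I}$, $Y\in\mathscr{Y}$. The quotient category $\mathscr{C}/\mathscr{X}$ has the objects of $\mathscr{C}$, and its morphisms $A\to B$ are elements of $\mathrm{Hom}_{\mathscr{C}}(A,B)$ modulo the subgroup of morphisms factoring through an object of $\mathscr{X}$. It is a known theorem (Zhou–Zhu, Liu–Nakaoka) that $\mathscr{C}/\mathscr{X}$ is abelian when $\mathscr{C}$ has enough projectives and enough injectives and $\mathscr{X}$ is cluster tilting. An abelian category with enough projectives and enough injectives is Gorenstein if all its projective objects have finite injective dimension and all its injective objects have finite projective dimension; the maximum of the injective dimensions of projectives and the projective dimensions of injectives is its Gorenstein dimension. *)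

(* Defs.v *)
From HB Require Import structures.
From mathcomp Require Import all_boot all_order all_algebra boolp.

Set Implicit Arguments.
Unset Strict Implicit.
Unset Printing Implicit Defensive.
Import GRing.Theory.
Local Open Scope ring_scope.
Local Open Scope quotient_scope.

#[projections(primitive)]
Record preadditive := Preadditive {
  ob :> Type;
  hom : ob -> ob -> zmodType;
  idm : forall A, hom A A;
  comp : forall A B D, hom B D -> hom A B -> hom A D;
  compA : forall A B D F (h : hom D F) (g : hom B D) (f : hom A B),
    comp h (comp g f) = comp (comp h g) f;
  comp1m : forall A B (f : hom A B), comp (idm B) f = f;
  compm1 : forall A B (f : hom A B), comp f (idm A) = f;
  compDl : forall A B D (g g' : hom B D) (f : hom A B),
    comp (g + g') f = comp g f + comp g' f;
  compDr : forall A B D (g : hom B D) (f f' : hom A B),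
    comp g (f + f') = comp g f + comp g f'
}.
Arguments hom {p} A B.
Arguments idm {p} A.
Notation "g \oc f" := (comp g f) (at level 40, left associativity).

Definition op (C : preadditive) : preadditive :=
  @Preadditive C (fun A B => @hom C B A) (@idm C)
    (fun A B D g f => f \oc g)
    (fun A B D F h g f => esym (compA f g h))
    (fun A B f => compm1 f) (fun A B f => comp1m f)
    (fun A B D g g' f => compDr f g g') (fun A B D g f f' => compDl f f' g).

Section Morphisms.
Variable C : preadditive.
Implicit Types A B D K Z : C.

Definition is_iso A B (f : hom A B) : Prop :=
  exists g : hom B A, g \oc f = idm A /\ f \oc g = idm B.

Definition is_mono A B (f : hom A B) : Prop :=
  forall W (u v : hom W A), f \oc u = f \oc v -> u = v.

Definition is_epi A B (f : hom A B) : Prop :=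
  forall W (u v : hom B W), u \oc f = v \oc f -> u = v.

Definition is_zero_obj Z : Prop :=
  (forall A (f : hom A Z), f = 0) /\ (forall A (f : hom Z A), f = 0).

Record biproduct A B := Biproduct {
  bip :> C;
  in1 : hom A bip;
  in2 : hom B bip;
  pr1 : hom bip A;
  pr2 : hom bip B;
  pr1in1 : pr1 \oc in1 = idm A;
  pr2in2 : pr2 \oc in2 = idm B;
  pr1in2 : pr1 \oc in2 = 0;
  pr2in1 : pr2 \oc in1 = 0;
  bip_sum : in1 \oc pr1 + in2 \oc pr2 = idm bip
}.

Definition is_kernel A B K (f : hom A B) (k : hom K A) : Prop :=
  f \oc k = 0 /\
  forall W (g : hom W A), f \oc g = 0 -> exists! u : hom W K, k \oc u = g.

Definition is_cokernel A B Q (f : hom A B) (q : hom B Q) : Prop :=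
  q \oc f = 0 /\
  forall W (g : hom B W), g \oc f = 0 -> exists! u : hom Q W, u \oc q = g.

(* The image of f is the kernel of g: f is an epimorphism onto Ker g. *)
Definition exact_at A B D (f : hom A B) (g : hom B D) : Prop :=
  exists (K : C) (k : hom K B) (u : hom A K),
    [/\ is_kernel g k, f = k \oc u & is_epi u].

End Morphisms.

Arguments is_zero_obj {C} Z.
Arguments biproduct {C} A B.
Arguments in1 {C A B} b.
Arguments in2 {C A B} b.
Arguments pr1 {C A B} b.
Arguments pr2 {C A B} b.

Definition is_additive (C : preadditive) : Prop :=
  (exists Z : C, is_zero_obj Z) /\ (forall A B : C, inhabited (biproduct A B)).

Definition is_abelian (C : preadditive) : Prop :=
  [/\ is_additive C,
      forall (A B : C) (f : hom A B), exists (K : C) (k : hom K A), is_kernel f k,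
      forall (A B : C) (f : hom A B), exists (Q : C) (q : hom B Q), is_cokernel f q,
      forall (A B : C) (f : hom A B), is_mono f ->
        exists (D : C) (g : hom B D), is_kernel g f
    & forall (A B : C) (f : hom A B), is_epi f ->
        exists (D : C) (g : hom D A), is_cokernel g f].

Definition projective_obj (C : preadditive) (P : C) : Prop :=
  forall (A B : C) (p : hom A B), is_epi p ->
  forall f : hom P B, exists g : hom P A, p \oc g = f.

Definition injective_obj (C : preadditive) (I : C) : Prop := @projective_obj (op C) I.

Definition enough_projectives (C : preadditive) : Prop :=
  forall M : C, exists (P : C) (p : hom P M), projective_obj P /\ is_epi p.

Definition enough_injectives (C : preadditive) : Prop :=
  enough_projectives (op C).

(* The projective dimension of M is at most n. *)
Definition pd_le (C : preadditive) (M : C) (n : nat) : Prop :=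
  exists (P : nat -> C) (d : forall i, hom (P i.+1) (P i)) (e : hom (P 0%N) M),
    [/\ forall i, projective_obj (P i),
        is_epi e,
        exact_at (d 0%N) e,
        forall i, exact_at (d i.+1) (d i)
      & forall i, (n < i)%N -> is_zero_obj (P i)].

Definition id_le (C : preadditive) (M : C) (n : nat) : Prop :=
  @pd_le (op C) M n.

Definition gorenstein (C : preadditive) : Prop :=
  (forall P : C, projective_obj P -> exists n, id_le P n) /\
  (forall I : C, injective_obj I -> exists n, pd_le I n).

Definition gorenstein_dim_le (C : preadditive) (n : nat) : Prop :=
  (forall P : C, projective_obj P -> id_le P n) /\
  (forall I : C, injective_obj I -> pd_le I n).

#[projections(primitive)]
Record biadditive_functor (C : preadditive) := BiadditiveFunctor {
  ext :> C -> C -> zmodType;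
  emap : forall (Z Z' A A' : C), hom Z' Z -> hom A A' ->
    {additive ext Z A -> ext Z' A'};
  emap_id : forall (Z A : C) (d : ext Z A), emap (idm Z) (idm A) d = d;
  emap_comp : forall (Z Z' Z'' A A' A'' : C)
    (c : hom Z' Z) (c' : hom Z'' Z') (a : hom A A') (a' : hom A' A'')
    (d : ext Z A),
    emap (c \oc c') (a' \oc a) d = emap c' a' (emap c a d);
  emapDl : forall (Z Z' A : C) (c c' : hom Z' Z) (d : ext Z A),
    emap (c + c') (idm A) d = emap c (idm A) d + emap c' (idm A) d;
  emapDr : forall (Z A A' : C) (a a' : hom A A') (d : ext Z A),
    emap (idm Z) (a + a') d = emap (idm Z) a d + emap (idm Z) a' d
}.

Definition op_ext (C : preadditive) (E : biadditive_functor C) :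
    biadditive_functor (op C) :=
  @BiadditiveFunctor (op C) (fun Z A => E A Z)
    (fun Z Z' A A' c a => emap E a c)
    (fun Z A d => emap_id d)
    (fun Z Z' Z'' A A' A'' c c' a a' d =>
       @emap_comp C E A A' A'' Z Z' Z'' a a' c c' d)
    (fun Z Z' A c c' d => @emapDr C E A Z Z' c c' d)
    (fun Z A A' a a' d => @emapDl C E A A' Z a a' d).

Section Extensions.
Variables (C : preadditive) (E : biadditive_functor C).

Definition push (Z A A' : C) (a : hom A A') (d : E Z A) : E Z A' :=
  emap E (idm Z) a d.

Definition pull (Z Z' A : C) (c : hom Z' Z) (d : E Z A) : E Z' A :=
  emap E c (idm A) d.

Definition ext_morphism (Z Z' A A' : C) (d : E Z A) (d' : E Z' A')
    (a : hom A A') (c : hom Z Z') : Prop :=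
  push a d = pull c d'.

(* The element whose components under
   E(Z + Z', A + A') = E(Z, A) + E(Z, A') + E(Z', A) + E(Z', A')
   are (d, 0, 0, d'). *)
Definition ext_sum (Z Z' A A' : C) (SZ : biproduct Z Z') (SA : biproduct A A')
    (d : E Z A) (d' : E Z' A') : E SZ SA :=
  emap E (pr1 SZ) (in1 SA) d + emap E (pr2 SZ) (in2 SA) d'.

End Extensions.

#[projections(primitive)]
Record sequence (C : preadditive) (A Z : C) := Seq {
  mid : C;
  infl : hom A mid;
  defl : hom mid Z
}.
Arguments Seq {C A Z mid} infl defl.

Definition seq_equiv (C : preadditive) (A Z : C) (S T : sequence A Z) : Prop :=
  exists b : hom (mid S) (mid T),
    [/\ is_iso b, b \oc infl S = infl T & defl T \oc b = defl S].

Definition op_seq (C : preadditive) (A Z : C) (S : @sequence (op C) A Z) :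
    @sequence C Z A :=
  @Seq C Z A (mid S) (defl S) (infl S).

Definition bip_map (C : preadditive) (A A' B B' : C)
    (S : biproduct A A') (T : biproduct B B') (f : hom A B) (f' : hom A' B') :
    hom S T :=
  in1 T \oc f \oc pr1 S + in2 T \oc f' \oc pr2 S.

(* [s d] is a set of sequences, meant to be one equivalence class; thus
   s(d) = [A -x-> B -y-> Z] is written [s A Z d (Seq x y)]. *)
Definition correspondence (C : preadditive) (E : biadditive_functor C) :=
  forall A Z : C, E Z A -> sequence A Z -> Prop.

Definition op_corr (C : preadditive) (E : biadditive_functor C)
    (s : correspondence E) : correspondence (op_ext E) :=
  fun A Z d S => s Z A d (op_seq S).

Section Realization.
Variables (C : preadditive) (E : biadditive_functor C) (s : correspondence E).
Arguments s {A Z} _ _.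

Definition realization : Prop :=
  (forall (A Z : C) (d : E Z A),
     exists S : sequence A Z, forall T, s d T <-> seq_equiv S T) /\
  (forall (A B Z A' B' Z' : C) (d : E Z A) (d' : E Z' A')
     (x : hom A B) (y : hom B Z) (x' : hom A' B') (y' : hom B' Z'),
     s d (Seq x y) -> s d' (Seq x' y') ->
     forall (a : hom A A') (c : hom Z Z'), ext_morphism d d' a c ->
     exists b : hom B B', b \oc x = x' \oc a /\ y' \oc b = c \oc y).

Definition additive_realization : Prop :=
  (forall (A Z : C) (S : biproduct A Z), s 0 (Seq (in1 S) (pr2 S))) /\
  (forall (A B Z A' B' Z' : C) (d : E Z A) (d' : E Z' A')
     (x : hom A B) (y : hom B Z) (x' : hom A' B') (y' : hom B' Z')
     (SA : biproduct A A') (SB : biproduct B B') (SZ : biproduct Z Z'),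
     s d (Seq x y) -> s d' (Seq x' y') ->
     s (ext_sum SZ SA d d') (Seq (bip_map SA SB x x') (bip_map SB SZ y y'))).

Definition ET3 : Prop :=
  forall (A B Z A' B' Z' : C) (d : E Z A) (d' : E Z' A')
    (x : hom A B) (y : hom B Z) (x' : hom A' B') (y' : hom B' Z'),
    s d (Seq x y) -> s d' (Seq x' y') ->
    forall (a : hom A A') (b : hom B B'), b \oc x = x' \oc a ->
    exists c : hom Z Z', ext_morphism d d' a c /\ c \oc y = y' \oc b.

Definition ET4 : Prop :=
  forall (A B B2 D F : C) (f : hom A B) (f' : hom B D)
    (g : hom B B2) (g' : hom B2 F) (d : E D A) (d' : E F B),
    s d (Seq f f') -> s d' (Seq g g') ->
    exists (G : C) (h : hom A B2) (h' : hom B2 G) (u : hom D G) (v : hom G F)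
      (d'' : E G A),
      [/\ h = g \oc f, h' \oc g = u \oc f' & v \oc h' = g'] /\
      [/\ s d'' (Seq h h'),
          s (push f' d') (Seq u v),
          pull u d'' = d
        & push f d'' = pull v d'].

Definition eprojective (P : C) : Prop :=
  forall (A B Z : C) (x : hom A B) (y : hom B Z) (d : E Z A),
    s d (Seq x y) -> forall f : hom P Z, exists g : hom P B, y \oc g = f.

Definition enough_eprojectives : Prop :=
  forall Z : C, exists (A P : C) (x : hom A P) (y : hom P Z) (d : E Z A),
    s d (Seq x y) /\ eprojective P.

Definition Omega (Y : C -> Prop) (K : C) : Prop :=
  exists (P Z : C) (x : hom K P) (y : hom P Z) (d : E Z K),
    [/\ s d (Seq x y), eprojective P & Y Z].

End Realization.

Record extriangulated (C : preadditive) (E : biadditive_functor C)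
    (s : correspondence E) : Prop := Extriangulated {
  extri_additive : is_additive C;
  extri_realization : realization s;
  extri_additive_realization : additive_realization s;
  extri_ET3 : ET3 s;
  extri_ET3op : ET3 (op_corr s);
  extri_ET4 : ET4 s;
  extri_ET4op : ET4 (op_corr s)
}.

Definition einjective (C : preadditive) (E : biadditive_functor C)
    (s : correspondence E) (I : C) : Prop :=
  @eprojective (op C) (op_ext E) (op_corr s) I.

Definition enough_einjectives (C : preadditive) (E : biadditive_functor C)
    (s : correspondence E) : Prop :=
  enough_eprojectives (op_corr s).

Definition Sigma (C : preadditive) (E : biadditive_functor C)
    (s : correspondence E) (Y : C -> Prop) (L : C) : Prop :=
  @Omega (op C) (op_ext E) (op_corr s) Y L.

(* A full subcategory is given by the predicate selecting its objects. *)

Definition contravariantly_finite (C : preadditive) (X : C -> Prop) : Prop :=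
  forall M : C, exists (Z : C) (f : hom Z M), X Z /\
    forall (Z' : C) (g : hom Z' M), X Z' -> exists h : hom Z' Z, f \oc h = g.

Definition functorially_finite (C : preadditive) (X : C -> Prop) : Prop :=
  contravariantly_finite X /\ @contravariantly_finite (op C) X.

Definition cluster_tilting (C : preadditive) (E : biadditive_functor C)
    (X : C -> Prop) : Prop :=
  [/\ functorially_finite X,
      forall M : C, X M <-> (forall Z : C, X Z -> forall d : E M Z, d = 0)
    & forall M : C, X M <-> (forall Z : C, X Z -> forall d : E Z M, d = 0)].

Record ideal (C : preadditive) := Ideal {
  imem :> forall A B : C, hom A B -> Prop;
  imem0 : forall A B : C, imem (0 : hom A B);
  imemB : forall (A B : C) (f g : hom A B), imem f -> imem g -> imem (f - g);
  imem_compl : forall (A B D : C) (g : hom B D) (f : hom A B),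
    imem f -> imem (g \oc f);
  imem_compr : forall (A B D : C) (g : hom B D) (f : hom A B),
    imem g -> imem (g \oc f)
}.
Arguments imem {C} i {A B} f.

Section QuotientHom.
Variables (C : preadditive) (J : ideal C) (A B : C).

Definition ipred : {pred hom A B} := fun f => `[< imem J f >].

Lemma ipred_zmod_closed : zmod_closed ipred.
Proof.
split=> [|f g]; first exact/asboolP/imem0.
by move=> /asboolP Jf /asboolP Jg; apply/asboolP/imemB.
Qed.

HB.instance Definition _ :=
  GRing.isZmodClosed.Build (hom A B) ipred ipred_zmod_closed.

Definition qhom : zmodType := {ideal_quot ipred}.
Definition qpi : hom A B -> qhom := \pi_{ideal_quot ipred}.

Lemma qpiP (f g : hom A B) : qpi f = qpi g <-> imem J (f - g).
Proof.
split=> [/eqP|Jfg]; first by rewrite -Quotient.idealrBE => /asboolP.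
by apply/eqP; rewrite -Quotient.idealrBE; apply/asboolP.
Qed.

Definition qrepr (u : qhom) : hom A B := repr (u : {ideal_quot ipred}).

Lemma qreprK u : qpi (qrepr u) = u.
Proof. exact: reprK. Qed.

Lemma qpiD (f g : hom A B) : qpi (f + g) = qpi f + qpi g.
Proof. exact: (raddfD (\pi_{ideal_quot ipred})). Qed.

End QuotientHom.

Section QuotientCategory.
Variables (C : preadditive) (J : ideal C).

Definition qcomp (A B D : C) (g : qhom J B D) (f : qhom J A B) : qhom J A D :=
  qpi J (qrepr g \oc qrepr f).

Lemma comp_subl (A B D : C) (g g' : hom B D) (f : hom A B) :
  (g - g') \oc f = g \oc f - g' \oc f.
Proof. by apply/(addIr (g' \oc f)); rewrite -compDl !subrK. Qed.

Lemma comp_subr (A B D : C) (g : hom B D) (f f' : hom A B) :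
  g \oc (f - f') = g \oc f - g \oc f'.
Proof. by apply/(addIr (g \oc f')); rewrite -compDr !subrK. Qed.

Lemma qcomp_pi (A B D : C) (g : hom B D) (f : hom A B) :
  qcomp (qpi J g) (qpi J f) = qpi J (g \oc f).
Proof.
have /qpiP Jg := qreprK (qpi J g); have /qpiP Jf := qreprK (qpi J f).
rewrite /qcomp; set g' := qrepr _ in Jg *; set f' := qrepr _ in Jf *.
transitivity (qpi J (g \oc f')); apply/qpiP.
  by rewrite -comp_subl; apply: imem_compr.
by rewrite -comp_subr; apply: imem_compl.
Qed.

Lemma qcompA (A B D F : C) (h : qhom J D F) (g : qhom J B D) (f : qhom J A B) :
  qcomp h (qcomp g f) = qcomp (qcomp h g) f.
Proof.
by rewrite -[h]qreprK -[g]qreprK -[f]qreprK !qcomp_pi compA.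
Qed.

Lemma qcomp1m (A B : C) (f : qhom J A B) : qcomp (qpi J (idm B)) f = f.
Proof. by rewrite -[f]qreprK qcomp_pi comp1m. Qed.

Lemma qcompm1 (A B : C) (f : qhom J A B) : qcomp f (qpi J (idm A)) = f.
Proof. by rewrite -[f]qreprK qcomp_pi compm1. Qed.

Lemma qcompDl (A B D : C) (g g' : qhom J B D) (f : qhom J A B) :
  qcomp (g + g') f = qcomp g f + qcomp g' f.
Proof.
by rewrite -[g]qreprK -[g']qreprK -[f]qreprK -qpiD !qcomp_pi compDl qpiD.
Qed.

Lemma qcompDr (A B D : C) (g : qhom J B D) (f f' : qhom J A B) :
  qcomp g (f + f') = qcomp g f + qcomp g f'.
Proof.
by rewrite -[g]qreprK -[f]qreprK -[f']qreprK -qpiD !qcomp_pi compDr qpiD.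
Qed.

Definition quotient_cat : preadditive :=
  @Preadditive C (fun A B => qhom J A B) (fun A => qpi J (idm A)) qcomp
    qcompA qcomp1m qcompm1 qcompDl qcompDr.

End QuotientCategory.

Section FactorIdeal.
Variables (C : preadditive) (E : biadditive_functor C) (X : C -> Prop).
Hypotheses (addC : is_additive C) (ctX : cluster_tilting E X).

Definition factors_through A B (f : @hom C A B) : Prop :=
  exists (Z : C) (g : hom Z B) (h : hom A Z), X Z /\ f = g \oc h.

Lemma cluster_tilting_zero (Z : C) : is_zero_obj Z -> X Z.
Proof.
case: ctX => _ _ ct [Z0 _]; apply/ct => W XW d.
rewrite -[d]emap_id (Z0 _ (idm Z)).
by apply: (addIr (emap E (idm W) 0 d)); rewrite -emapDr addr0 add0r.
Qed.

Lemma cluster_tilting_biproduct (A B : C) (S : biproduct A B) :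
  X A -> X B -> X S.
Proof.
case: ctX => _ _ ct XA XB; apply/ct => W XW d.
have split_pr (D : C) (i : hom D S) (p : hom S D) :
    X D -> emap E (idm W) (i \oc p) d = 0.
  move=> XD; rewrite -[idm W]comp1m emap_comp.
  by rewrite (iffLR (ct D) XD W XW (emap E _ p d)) raddf0.
by rewrite -[d]emap_id -(bip_sum S) emapDr !split_pr // addr0.
Qed.

Lemma factors0 A B : factors_through (0 : @hom C A B).
Proof.
have [[Z Z0] _] := addC; exists Z, 0, 0; split.
  exact: cluster_tilting_zero.
by apply: (addIr ((0 : hom Z B) \oc (0 : hom A Z))); rewrite -compDr addr0 add0r.
Qed.

Lemma factorsB A B (f f' : @hom C A B) :
  factors_through f -> factors_through f' -> factors_through (f - f').
Proof.
move=> [Z [g [h [XZ ->]]]] [Z' [g' [h' [XZ' ->]]]].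
have [S] := addC.2 Z Z'.
exists S, (g \oc pr1 S - g' \oc pr2 S), (in1 S \oc h + in2 S \oc h').
split; first exact: cluster_tilting_biproduct.
have comp0m (U V W : C) (k : hom U V) : (0 : hom V W) \oc k = 0.
  by rewrite -[X in X \oc _](subrr (0 : hom V W)) comp_subl subrr.
have compm0 (U V W : C) (k : hom V W) : k \oc (0 : hom U V) = 0.
  by rewrite -[X in _ \oc X](subrr (0 : hom U V)) comp_subr subrr.
rewrite comp_subl !compDr !compA -!(compA _ (pr1 S)) -!(compA _ (pr2 S)).
rewrite (pr1in1 S) (pr1in2 S) (pr2in1 S) (pr2in2 S).
by rewrite !compm1 !compm0 !comp0m addr0 add0r.
Qed.

Lemma factors_compl A B D (g : @hom C B D) (f : hom A B) :
  factors_through f -> factors_through (g \oc f).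
Proof. by move=> [Z [u [v [XZ ->]]]]; exists Z, (g \oc u), v; rewrite compA. Qed.

Lemma factors_compr A B D (g : @hom C B D) (f : hom A B) :
  factors_through g -> factors_through (g \oc f).
Proof. by move=> [Z [u [v [XZ ->]]]]; exists Z, u, (v \oc f); rewrite compA. Qed.

(* The morphisms factoring through an object of a cluster tilting subcategory
   form an ideal, since the subcategory is closed under finite direct sums. *)
Definition factor_ideal : ideal C :=
  @Ideal C factors_through factors0 factorsB factors_compl factors_compr.

End FactorIdeal.

(* Main.v *)
(* Pairing a map f : A -> B with a left X-approximation A -> X0 replaces f by an
   inflation A -> B + X0, isomorphic to f in the quotient, along which every map
   A -> X' with X' in X extends. For such an inflation the deflation B + X0 -> N
   is a cokernel of f in the quotient. If f is a monomorphism in the quotient,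
   then E(X', f) is injective for X' in X, and this makes f a kernel of
   B + X0 -> N. With the dual statements, the quotient is abelian.

   The objects of Omega X are projective in the quotient and cover it. For K in
   Omega X with X-resolution X1 -> X0 -> K, composing X1 -> X0 with an inflation
   X0 -> I, I injective, gives by (ET4) a triangle K -> G -> J with G and J in
   Sigma X. If Sigma (Omega X) lies in X, then maps from K to X extend over an
   injective object, hence over G, so that 0 -> K -> G -> J -> 0 is exact in the
   quotient: an injective resolution of length one. Every projective is a
   retract of such a K. The dual argument bounds the dimension of injectives. *)

From mathcomp Require Import all_boot all_algebra.
Require Import Defs.

Set Implicit Arguments.
Unset Strict Implicit.
Unset Printing Implicit Defensive.
Import GRing.Theory.
Local Open Scope ring_scope.

(** * Preadditive categories and their opposites *)

Section Preadditive.
Variable C : preadditive.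

Lemma compm0 (A B D : C) (g : hom B D) : g \oc (0 : hom A B) = 0.
Proof. by rewrite -[X in _ \oc X](subrr (0 : hom A B)) comp_subr subrr. Qed.

Lemma comp0m (A B D : C) (f : hom A B) : (0 : hom B D) \oc f = 0.
Proof. by rewrite -[X in X \oc _](subrr (0 : hom B D)) comp_subl subrr. Qed.

Definition op_biproduct (A B : C) (S : biproduct A B) : @biproduct (op C) A B :=
  @Biproduct (op C) A B S (pr1 S) (pr2 S) (in1 S) (in2 S)
    (pr1in1 S) (pr2in2 S) (pr2in1 S) (pr1in2 S) (bip_sum S).

Definition unop_biproduct (A B : C) (S : @biproduct (op C) A B) :
    biproduct A B :=
  @Biproduct C A B S (pr1 S) (pr2 S) (in1 S) (in2 S)
    (pr1in1 S) (pr2in2 S) (pr2in1 S) (pr1in2 S) (bip_sum S).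

Lemma swap_biproduct_sum (A B : C) (S : biproduct A B) :
  in2 S \oc pr2 S + in1 S \oc pr1 S = idm S.
Proof. by rewrite addrC bip_sum. Qed.

Definition swap_biproduct (A B : C) (S : biproduct A B) : biproduct B A :=
  Biproduct (pr2in2 S) (pr1in1 S) (pr2in1 S) (pr1in2 S) (swap_biproduct_sum S).

Section ZeroBiproduct.
Variables (A Z : C) (Z0 : is_zero_obj Z).

Lemma zero_biproduct_pr2in2 : (0 : hom A Z) \oc (0 : hom Z A) = idm Z.
Proof. by rewrite compm0 [RHS]Z0.1. Qed.

Lemma zero_biproduct_sum :
  idm A \oc idm A + (0 : hom Z A) \oc (0 : hom A Z) = idm A.
Proof. by rewrite comp1m compm0 addr0. Qed.

(** Its split triangle is [A = A -> 0], and after [swap_biproduct] it is [0 -> A = A]. Comparison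
    with these triangles produces the exact sequences. *)
Definition zero_biproduct : biproduct A Z :=
  Biproduct (comp1m (idm A)) zero_biproduct_pr2in2 (comp1m 0) (compm1 0)
    zero_biproduct_sum.

End ZeroBiproduct.

Section GraphBiproduct.
Variables (A B : C) (S : biproduct A B) (f : hom A B).

Let i := in1 S + in2 S \oc f.
Let p := pr2 S - f \oc pr1 S.

Lemma graph_pr1in1 : pr1 S \oc i = idm A.
Proof. by rewrite compDr compA pr1in1 pr1in2 comp0m addr0. Qed.

Lemma graph_pr2in2 : p \oc in2 S = idm B.
Proof. by rewrite comp_subl -compA pr2in2 pr1in2 compm0 subr0. Qed.

Lemma graph_pr2in1 : p \oc i = 0.
Proof.
rewrite compDr !comp_subl !compA -!(compA _ (pr1 S)) pr2in1 pr1in1 pr2in2.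
by rewrite pr1in2 compm0 comp0m subr0 comp1m compm1 sub0r addNr.
Qed.

Lemma graph_sum : i \oc pr1 S + in2 S \oc p = idm S.
Proof. by rewrite compDl comp_subr compA addrACA subrr addr0 bip_sum. Qed.

(** The structure of [S] twisted by a unipotent automorphism, so that [(1, f)] becomes a split
    inflation. *)
Definition graph_biproduct : biproduct A B :=
  Biproduct graph_pr1in1 graph_pr2in2 (pr1in2 S) graph_pr2in1 graph_sum.

End GraphBiproduct.

End Preadditive.

(** * Functoriality of extensions *)

Section ExtensionActions.
Variables (C : preadditive) (E : biadditive_functor C).

Lemma push_id (Z A : C) (d : E Z A) : push (idm A) d = d.
Proof. exact: emap_id. Qed.

Lemma pull_id (Z A : C) (d : E Z A) : pull (idm Z) d = d.
Proof. exact: emap_id. Qed.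

Lemma push_comp (Z A A' A'' : C) (a : hom A A') (a' : hom A' A'') (d : E Z A) :
  push (a' \oc a) d = push a' (push a d).
Proof. by rewrite /push -{1}(comp1m (idm Z)) emap_comp. Qed.

Lemma pull_comp (Z Z' Z'' A : C) (c : hom Z' Z) (c' : hom Z'' Z') (d : E Z A) :
  pull (c \oc c') d = pull c' (pull c d).
Proof. by rewrite /pull -{1}(comp1m (idm A)) emap_comp. Qed.

Lemma push_pull (Z Z' A A' : C) (a : hom A A') (c : hom Z' Z) (d : E Z A) :
  push a (pull c d) = pull c (push a d).
Proof. by rewrite /push /pull -!emap_comp !comp1m !compm1. Qed.

Lemma push0 (Z A A' : C) (a : hom A A') : push a (0 : E Z A) = 0.
Proof. exact: raddf0. Qed.

Lemma pull0 (Z Z' A : C) (c : hom Z' Z) : pull c (0 : E Z A) = 0.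
Proof. exact: raddf0. Qed.

End ExtensionActions.

(** * The opposite extriangulated category *)

Section Duality.
Variables (C : preadditive) (E : biadditive_functor C) (s : correspondence E).

(** ET3 and ET4 trade places with their duals. An equivalence of sequences is reversed by inverting
    its isomorphism, and a split sequence by swapping the summands. *)
Lemma op_extriangulated : extriangulated s -> extriangulated (op_corr s).
Proof.
case=> [[[Z0 [z1 z2]] bipC] [rl1 rl2] [ar1 ar2] et3 et3o et4 et4o].
split=> //.
- split; first by exists Z0; split=> [A f|A f]; [exact: z2|exact: z1].
  by move=> A B; case: (bipC A B) => S; exists; exact: op_biproduct.
- split=> [A Z d|A B Z A' B' Z' d d' x y x' y' sd sd' a c ac].
    have [[M i p] sP] := rl1 Z A d.
    exists (@Seq (op C) A Z M p i) => -[M' p' i'].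
    rewrite /op_corr sP; split=> -[b [[b' [/= b1 b2]] /= ba bb]].
      by exists b'; split; [exists b| rewrite /= -bb -compA b2 compm1|
                                     rewrite /= -ba compA b1 comp1m].
    by exists b'; split; [exists b| rewrite /= -bb compA b2 comp1m|
                                     rewrite /= -ba -compA b1 compm1].
  have [b [b1 b2]] := rl2 _ _ _ _ _ _ _ _ _ _ _ _ sd' sd c a (esym ac).
  by exists b.
- split=> [A Z S|A B Z A' B' Z' d d' x y x' y' SA SB SZ sd sd'].
    exact: (ar1 _ _ (swap_biproduct (unop_biproduct S))).
  have := ar2 _ _ _ _ _ _ _ _ _ _ _ _ (unop_biproduct SZ) (unop_biproduct SB)
    (unop_biproduct SA) sd sd'.
  by rewrite /bip_map /op_corr /op_seq /= -!compA.
Qed.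

End Duality.

(** * Exact sequences of an extriangulated category *)

Section ExactSequences.
Variables (C : preadditive) (E : biadditive_functor C) (s : correspondence E).
Hypothesis hC : extriangulated s.
Arguments s {A Z} _ _.

Lemma split_triangle (A Z : C) (S : biproduct A Z) : s 0 (Seq (in1 S) (pr2 S)).
Proof. by case: hC => _ _ [split _] _ _ _ _; apply: split. Qed.

Lemma realize (A Z : C) (d : E Z A) :
  exists (B : C) (x : hom A B) (y : hom B Z), s d (Seq x y).
Proof.
case: hC => _ [/(_ _ _ d) [[B x y] sP] _] _ _ _ _ _; exists B, x, y.
apply/sP; exists (idm B); split; rewrite /= ?comp1m ?compm1 //.
by exists (idm B); rewrite comp1m.
Qed.

Section Triangle.
Variables (A B Z : C) (x : hom A B) (y : hom B Z) (d : E Z A).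
Hypothesis sd : s d (Seq x y).

(** ET3 applied to [A = A -> 0] with components [idm A] and [x] makes [y \oc x] pass through a zero
    object. *)
Lemma triangle_comp0 : y \oc x = 0.
Proof.
have [Z0 z0] := (extri_additive hC).1.
have [|c [_ /= <-]] := extri_ET3 hC (split_triangle (zero_biproduct A z0)) sd
  (a := idm A) (b := x); first by rewrite /= compm1.
by rewrite compm0.
Qed.

Lemma triangle_coker W (f : hom B W) : f \oc x = 0 ->
  exists g : hom Z W, f = g \oc y.
Proof.
move=> fx; have [Z0 z0] := (extri_additive hC).1.
have sW := split_triangle (swap_biproduct (zero_biproduct W z0)).
have [|c [_ /= cy]] := extri_ET3 hC sd sW (a := 0) (b := f).
  by rewrite fx compm0.
by exists c; rewrite cy comp1m.
Qed.

(** Both directions compare [d] with [W = W -> 0]: the morphism of extensions [(f, 0)] lifts to the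
    middle terms, and ET3 turns an extension of [f] to [B] into a morphism to the zero class. *)
Lemma push_eq0P W (f : hom A W) :
  push f d = 0 <-> exists g : hom B W, f = g \oc x.
Proof.
have [Z0 z0] := (extri_additive hC).1.
have sW := split_triangle (zero_biproduct W z0).
split=> [fd|[g ->]].
  have [|b [/= bx _]] := (extri_realization hC).2 _ _ _ _ _ _ _ _ _ _ _ _
    sd sW f 0; first by rewrite /ext_morphism fd pull0.
  by exists b; rewrite bx comp1m.
have [|c [-> _]] := extri_ET3 hC sd sW (a := g \oc x) (b := g).
  by rewrite /= comp1m.
exact: pull0.
Qed.

Lemma triangle_push0 : push x d = 0.
Proof. by apply/push_eq0P; exists (idm B); rewrite comp1m. Qed.

End Triangle.

End ExactSequences.

Lemma extri_ET3_dual (C : preadditive) (E : biadditive_functor C)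
    (s : correspondence E) (hC : extriangulated s) (A B Z A' B' Z' : C)
    (x : hom A B) (y : hom B Z) (d : E Z A)
    (x' : hom A' B') (y' : hom B' Z') (d' : E Z' A')
    (b : hom B B') (c : hom Z Z') :
  s _ _ d (Seq x y) -> s _ _ d' (Seq x' y') -> y' \oc b = c \oc y ->
  exists a : hom A A', push a d = pull c d' /\ b \oc x = x' \oc a.
Proof.
move=> sd sd' yb.
have [a [ac xa]] := @extri_ET3op _ _ _ hC
  _ _ _ _ _ _ d' d y' x' y x sd' sd c b yb.
by exists a; split; [exact: esym ac|exact: esym xa].
Qed.

Section DualExactSequences.
Variables (C : preadditive) (E : biadditive_functor C) (s : correspondence E).
Hypothesis hC : extriangulated s.
Let hCop := op_extriangulated hC.
Variables (A B Z : C) (x : hom A B) (y : hom B Z) (d : E Z A).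
Hypothesis sd : s d (Seq x y).

Lemma triangle_ker W (f : hom W B) : y \oc f = 0 ->
  exists g : hom W A, f = x \oc g.
Proof. exact: (@triangle_coker _ _ _ hCop Z B A y x d sd W f). Qed.

Lemma pull_eq0P W (f : hom W Z) :
  pull f d = 0 <-> exists g : hom W B, f = y \oc g.
Proof. exact: (@push_eq0P _ _ _ hCop Z B A y x d sd W f). Qed.

(** Since [x] extends over the middle term of [e], ET3 with the identity of [A] compares [e] with
    [d]. *)
Lemma push_infl_eq0 W (e : E W A) : push x e = 0 ->
  exists f : hom W Z, e = pull f d.
Proof.
have [M [i [p se]]] := realize hC e.
move=> /(push_eq0P hC se)[g xg].
have [|c [ec _]] := extri_ET3 hC se sd (a := idm A) (b := g).
  by rewrite compm1 xg.
by exists c; rewrite -ec push_id.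
Qed.

End DualExactSequences.

Lemma pull_defl_eq0 (C : preadditive) (E : biadditive_functor C)
    (s : correspondence E) (hC : extriangulated s)
    (A B Z : C) (x : hom A B) (y : hom B Z) (d : E Z A) W (e : E Z W) :
  s _ _ d (Seq x y) -> pull y e = 0 -> exists f : hom A W, e = push f d.
Proof.
move=> sd.
exact: (@push_infl_eq0 _ _ _ (op_extriangulated hC) Z B A y x d sd W e).
Qed.

(* (x, f) is the composite of the split inflation (1, f) : A -> A + D with the
   inflation x + 1 : A + D -> B + D. *)
Lemma inflation_sum (C : preadditive) (E : biadditive_functor C)
    (s : correspondence E) (hC : extriangulated s)
    (A B Z D : C) (x : hom A B) (y : hom B Z) (d : E Z A)
    (f : hom A D) (S : biproduct B D) : s _ _ d (Seq x y) ->
  exists (G : C) (g : hom S G) (d' : E G A),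
    s _ _ d' (Seq (in1 S \oc x + in2 S \oc f) g).
Proof.
move=> sd; have [[Z0 z0] /(_ A D)[SA]] := extri_additive hC.
have sD := split_triangle hC (zero_biproduct D z0).
have sS := (extri_additive_realization hC).2 _ _ _ _ _ _ _ _ _ _ _ _
  SA S (zero_biproduct Z z0) sd sD.
have [G [_ [g [u [v [d' [[-> _ _] [sd' _ _ _]]]]]]]] :=
  extri_ET4 hC (split_triangle hC (graph_biproduct SA f)) sS.
exists G, g, d'; move: sd'.
rewrite /= /bip_map compm1 compDl !compDr !(compA _ (in2 SA)).
rewrite -!(compA _ (pr1 SA)) -!(compA _ (pr2 SA)) pr1in1 pr1in2 pr2in1 pr2in2.
by rewrite !(comp0m, compm0, compm1, comp1m) addr0 add0r.
Qed.

(** * The quotient by a cluster tilting subcategory *)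

(* [q] exhibits [Q] as the quotient of [C] by the ideal of the morphisms
   factoring through [X]; unlike [quotient_cat], this is self-dual. *)
Record is_quotient (C Q : preadditive) (X : C -> Prop) (o : C -> Q)
    (q : forall A B : C, hom A B -> hom (o A) (o B)) : Prop := IsQuotient {
  quot_obj : forall M : Q, exists A : C, o A = M;
  quotD : forall A B (f g : hom A B), q _ _ (f + g) = q _ _ f + q _ _ g;
  quot1 : forall A, q _ _ (idm A) = idm (o A);
  quotM : forall A B D (g : hom B D) (f : hom A B),
    q _ _ (g \oc f) = q _ _ g \oc q _ _ f;
  quot_full : forall A B (u : hom (o A) (o B)), exists f : hom A B, u = q _ _ f;
  quot_eq0 : forall A B (f : hom A B), q _ _ f = 0 <-> factors_through X f
}.

(** The standing hypotheses are bundled in a form stable under passage to opposites, so each later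
    result dualizes by instantiation. *)
Record tilting_quotient (C : preadditive) (E : biadditive_functor C)
    (s : correspondence E) (X : C -> Prop) (Q : preadditive) (o : C -> Q)
    (q : forall A B : C, hom A B -> hom (o A) (o B)) : Prop := TiltingQuotient {
  tq_extri : extriangulated s;
  tq_proj : enough_eprojectives s;
  tq_inj : enough_einjectives s;
  tq_tilting : cluster_tilting E X;
  tq_quot : is_quotient X q
}.

Lemma op_is_quotient (C Q : preadditive) (X : C -> Prop) (o : C -> Q)
    (q : forall A B : C, hom A B -> hom (o A) (o B)) :
  is_quotient X q -> @is_quotient (op C) (op Q) X o (fun A B => q B A).
Proof.
case=> qo qD q1 qM qf q0; split=> //.
- by move=> A B f g; exact: qD.
- by move=> A B D g f; exact: qM.
- by move=> A B u; exact: qf.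
by move=> A B f; apply: iff_trans (q0 _ _ f) _; split=> -[Z [g [h [XZ ->]]]];
  exists Z, h, g.
Qed.

Lemma op_tilting_quotient (C : preadditive) (E : biadditive_functor C)
    (s : correspondence E) (X : C -> Prop) (Q : preadditive) (o : C -> Q)
    (q : forall A B : C, hom A B -> hom (o A) (o B)) :
  tilting_quotient s X q ->
  @tilting_quotient (op C) (op_ext E) (op_corr s) X (op Q) o (fun A B => q B A).
Proof.
case=> hC hP hI [[ct1 ct2] ct3 ct4] hq; split=> //.
- exact: op_extriangulated.
- exact: op_is_quotient.
Qed.

Section Quotient.
Variables (C : preadditive) (E : biadditive_functor C) (s : correspondence E).
Variables (X : C -> Prop) (Q : preadditive) (o : C -> Q).
Variable q : forall A B : C, hom A B -> hom (o A) (o B).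

Hypothesis hS : tilting_quotient s X (@q).

Let hC := tq_extri hS.
Let hQ := tq_quot hS.

Lemma quot0 (A B : C) : q (0 : hom A B) = 0.
Proof. by apply: (addIr (q 0)); rewrite -(quotD hQ) addr0 add0r. Qed.

Lemma quotB (A B : C) (f g : hom A B) : q (f - g) = q f - q g.
Proof. by apply: (addIr (q g)); rewrite -(quotD hQ) !subrK. Qed.

Lemma quot_to_X (A B : C) (f : hom A B) : X B -> q f = 0.
Proof.
by move=> XB; apply/(quot_eq0 hQ); exists B, (idm B), f; rewrite comp1m.
Qed.

Lemma quot_from_X (A B : C) (f : hom A B) : X A -> q f = 0.
Proof.
by move=> XA; apply/(quot_eq0 hQ); exists A, f, (idm A); rewrite compm1.
Qed.

Lemma quot_epi (A B : C) (f : hom A B) :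
  (forall W (w : hom B W), q (w \oc f) = 0 -> q w = 0) -> is_epi (q f).
Proof.
move=> epif M u v uv; have [W oW] := quot_obj hQ M.
case: M / oW u v uv => u v.
have [[w ->] [w' ->]] := (quot_full hQ u, quot_full hQ v).
rewrite -!(quotM hQ) => ww; apply/eqP; rewrite -subr_eq0 -quotB; apply/eqP.
by apply: epif; rewrite comp_subl quotB ww subrr.
Qed.

Lemma ext_XX (Z W : C) (d : E Z W) : X Z -> X W -> d = 0.
Proof. by case: (tq_tilting hS) => _ ct _ XZ XW; apply: (iffLR (ct Z)). Qed.

(** [M] is a retract of an object of [X], so its extensions by objects of [X] vanish. *)
Lemma X_of_quot_id0 (M : C) : q (idm M) = 0 -> X M.
Proof.
case/(quot_eq0 hQ) => Z [g [h [XZ idM]]].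
case: (tq_tilting hS) => _ ct _; apply/ct => W XW d.
by rewrite -[d]pull_id idM pull_comp (ext_XX (pull g d) XZ XW) pull0.
Qed.

Lemma eprojective_ext0 (P A : C) (d : E P A) : eprojective s P -> d = 0.
Proof.
move=> prP; have [B [x [y sd]]] := realize hC d; rewrite -[d]pull_id.
by apply/(pull_eq0P hC sd); have [g <-] := prP _ _ _ _ _ _ sd (idm P); exists g.
Qed.

Lemma eprojective_X (P : C) : eprojective s P -> X P.
Proof.
move=> prP; case: (tq_tilting hS) => _ ct _; apply/ct => W XW d.
exact: eprojective_ext0.
Qed.

Lemma biproduct_X (A B : C) (S : biproduct A B) : X A -> X B -> X S.
Proof. exact: cluster_tilting_biproduct (tq_tilting hS) _ _ S. Qed.

(** When [B] lies in [X], this says that [f] is a left [X]-approximation. *)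
Definition X_monic (A B : C) (f : hom A B) : Prop :=
  forall Z (a : hom A Z), X Z -> exists b : hom B Z, a = b \oc f.

Lemma triangle_X_monic (A B Z : C) (x : hom A B) (y : hom B Z) (d : E Z A) :
  s d (Seq x y) -> X Z -> X_monic x.
Proof. by move=> sd XZ W a XW; apply/(push_eq0P hC sd)/ext_XX. Qed.

End Quotient.

(** * Approximations by [X], monomorphisms and kernels *)

Section DualQuotient.
Variables (C : preadditive) (E : biadditive_functor C) (s : correspondence E).
Variables (X : C -> Prop) (Q : preadditive) (o : C -> Q).
Variable q : forall A B : C, hom A B -> hom (o A) (o B).

Hypothesis hS : tilting_quotient s X (@q).

Let hC := tq_extri hS.
Let hQ := tq_quot hS.
Let hSop := op_tilting_quotient hS.

Lemma einjective_X (I : C) : einjective s I -> X I.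
Proof. exact: (@eprojective_X _ _ _ _ _ _ _ hSop I). Qed.

(** A left approximation need not be an inflation; adding an inflation into an injective object,
    which lies in [X], makes it one. *)
Lemma X_coresolution (M : C) :
  exists (X0 X1 : C) (x : hom M X0) (y : hom X0 X1) (d : E X1 M),
    [/\ s d (Seq x y), X X0 & X X1].
Proof.
have [[_ /(_ M)[X' [/= a [XX' aP]]]] _ ct] := tq_tilting hS.
have [L [I [i [j [d [sd injI]]]]]] := tq_inj hS M.
have [_ /(_ I X')[S]] := extri_additive hC.
have [G [g [d' sd']]] := inflation_sum hC a S (sd : s d (@Seq C M L I j i)).
have XS : X S by apply: (biproduct_X hS) => //; exact: einjective_X.
exists S, G, (in1 S \oc j + in2 S \oc a), g, d'; split=> //.
(* The third term is in [X]: [e] dies on [S], so it is [push w d'] for some [w : M -> W], and [w]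
   extends over [S] by approximation. *)
have [_ ct1 _] := tq_tilting hS; apply/ct1 => W XW e.
have [|w ->] := pull_defl_eq0 hC sd' (e := e); first exact: (ext_XX hS).
apply/(push_eq0P hC sd'); have [b <-] := aP _ w XW.
exists (b \oc pr2 S); rewrite compDr !compA -!(compA _ (pr2 S)) pr2in1 pr2in2.
by rewrite compm0 comp0m compm1 add0r.
Qed.

(** For a syzygy [K -> P -> Z], the class [e] is pushed from some [a : K -> A]. If [f] kills [e],
    then [f \oc a] extends over [P], which is in [X]; hence [a] factors through [X], and extensions
    between objects of [X] vanish. *)
Lemma mono_ext_inj (A B Z : C) (f : hom A B) (e : E Z A) :
  is_mono (q f) -> X Z -> push f e = 0 -> e = 0.
Proof.
move=> monof XZ fe; have [K [P [k [p [d [sd prP]]]]]] := tq_proj hS Z.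
have XP := eprojective_X hS prP.
have [|a ea] := pull_defl_eq0 hC sd (e := e).
  exact: (eprojective_ext0 hS).
move: fe; rewrite ea -push_comp => /(push_eq0P hC sd)[g fa].
have /(quot_eq0 hQ)[W [t [b [XW ->]]]] : q a = 0.
  apply: monof; rewrite -!(quotM hQ) fa (quotM hQ) (quot_from_X hS g XP).
  by rewrite comp0m compm0.
by rewrite push_comp (ext_XX hS (push b d)) ?push0.
Qed.

Lemma mono_triangle_kernel (A B N : C) (f : hom A B) (g : hom B N) (d : E N A) :
  s d (Seq f g) -> is_mono (q f) -> is_kernel (q g) (q f).
Proof.
move=> sd monof; split=> [|M].
  by rewrite -(quotM hQ) (triangle_comp0 hC sd) (quot0 hS).
have [W oW] := quot_obj hQ M; case: M / oW => u0.
have [u ->] := quot_full hQ u0; rewrite -(quotM hQ).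
move=> /(quot_eq0 hQ)[Z [b [a [XZ gu]]]].
(* Lifting [b] along [g] corrects [u], without changing its class, to a map killed by [g]. *)
have /(pull_eq0P hC sd)[c bc] : pull b d = 0.
  apply: (mono_ext_inj monof XZ); rewrite push_pull.
  by rewrite (triangle_push0 hC sd) pull0.
have [|w uw] := triangle_ker hC sd (f := u - c \oc a).
  by rewrite comp_subr gu bc compA subrr.
have quw : q f \oc q w = q u.
  rewrite -(quotM hQ) -uw (quotB hS) (quotM hQ) (quot_to_X hS a XZ).
  by rewrite compm0 subr0.
by exists (q w); split=> // w' quw'; apply: monof; rewrite quw quw'.
Qed.

(** The maps [i] and [p] are the injection and projection of the summand [B]; they become inverse
    because the other summand is in [X]. *)
Lemma cone (A B : C) (f : hom A B) :
  exists (B' N : C) (i : hom B B') (p : hom B' B) (f' : hom A B') (g : hom B' N)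
    (d : E N A),
    [/\ s d (Seq f' g), X_monic X f', p \oc f' = f, q p \oc q i = idm (o B)
      & q i \oc q p = idm (o B')].
Proof.
have [X0 [X1 [x [y [e [se XX0 XX1]]]]]] := X_coresolution A.
have [_ /(_ X0 B)[S]] := extri_additive hC.
have [N [g [d sd]]] := inflation_sum hC f S se.
exists S, N, (in2 S), (pr2 S), (in1 S \oc x + in2 S \oc f), g, d; split=> //.
- move=> Z a XZ; have [b ->] := triangle_X_monic hS se XX1 a XZ.
  exists (b \oc pr1 S); rewrite compDr !compA -!(compA _ (pr1 S)) pr1in1 pr1in2.
  by rewrite compm0 comp0m compm1 addr0.
- by rewrite compDr !compA pr2in1 pr2in2 comp0m comp1m add0r.
- by rewrite -(quotM hQ) pr2in2 (quot1 hQ).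
rewrite -(quotM hQ) -(quot1 hQ) -(bip_sum S) (quotD hQ).
by rewrite [q (in1 S \oc _)](quotM hQ) (quot_to_X hS (pr1 S) XX0) compm0 add0r.
Qed.

(* A map w with wu in the ideal kills d = u_* d', since E(X1, -) vanishes on X;
   hence w extends over X0. *)
Lemma triangle_map_epi (M X0 X1 K : C) (x : hom M X0) (y : hom X0 X1)
    (d : E X1 M) (d' : E X1 K) (u : hom K M) :
  s d (Seq x y) -> X X0 -> X X1 -> push u d' = d -> is_epi (q u).
Proof.
move=> sd XX0 XX1 ud; apply: (quot_epi hS) => W w.
move=> /(quot_eq0 hQ)[Z [t [a [XZ wu]]]].
have /(push_eq0P hC sd)[b ->] : push w d = 0.
  by rewrite -ud -push_comp wu push_comp (ext_XX hS (push a d')) ?push0.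
by rewrite (quotM hQ) (quot_from_X hS b XX0) comp0m.
Qed.

End DualQuotient.

(** * Epimorphisms, cokernels and enough projectives *)

Section AbelianQuotient.
Variables (C : preadditive) (E : biadditive_functor C) (s : correspondence E).
Variables (X : C -> Prop) (Q : preadditive) (o : C -> Q).
Variable q : forall A B : C, hom A B -> hom (o A) (o B).

Hypothesis hS : tilting_quotient s X (@q).

Let hC := tq_extri hS.
Let hQ := tq_quot hS.
Let hSop := op_tilting_quotient hS.

Lemma epi_triangle_cokernel (A B N : C) (f : hom A B) (g : hom B N)
    (d : E N A) :
  s d (Seq f g) -> is_epi (q g) -> is_cokernel (q f) (q g).
Proof. exact: (@mono_triangle_kernel _ _ _ _ _ _ _ hSop N B A g f d). Qed.

Lemma X_resolution (M : C) :
  exists (X1 X0 : C) (x : hom X1 X0) (y : hom X0 M) (d : E M X1),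
    [/\ s d (Seq x y), X X0 & X X1].
Proof.
have [X0 [X1 [x [y [d h]]]]] := @X_coresolution _ _ _ _ _ _ _ hSop M.
by exists X1, X0, y, x, d.
Qed.

Lemma triangle_map_mono (M X0 X1 K : C) (x : hom X1 X0) (y : hom X0 M)
    (d : E M X1) (d' : E K X1) (u : hom M K) :
  s d (Seq x y) -> X X0 -> X X1 -> pull u d' = d -> is_mono (q u).
Proof. exact: (@triangle_map_epi _ _ _ _ _ _ _ hSop M X0 X1 K y x d d' u). Qed.

(** A map [w] with [w \oc g] in the ideal must lift to the term [X0] of an [X]-resolution of its
    target. The obstruction [pull w e] dies on [B], so it is [push b d] with [b] into [X1]; as [b]
    extends along [f], it vanishes. *)
Lemma X_monic_epi (A B N : C) (f : hom A B) (g : hom B N) (d : E N A) :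
  s d (Seq f g) -> X_monic X f -> is_epi (q g).
Proof.
move=> sd monf; apply: (quot_epi hS) => W w /(quot_eq0 hQ)[Z [t [a [XZ wg]]]].
have [X1 [X0 [x [y [e [se XX0 XX1]]]]]] := X_resolution W.
have [|b ew] := pull_defl_eq0 hC sd (e := pull w e).
  by rewrite -pull_comp wg pull_comp (ext_XX hS (pull t e)) ?pull0.
have /(pull_eq0P hC se)[c ->] : pull w e = 0.
  rewrite ew; have [c ->] := monf _ b XX1; rewrite push_comp.
  by rewrite (triangle_push0 hC sd) push0.
by rewrite (quotM hQ) (quot_to_X hS c XX0) compm0.
Qed.

Lemma X_monic_cokernel (A B N : C) (f : hom A B) (g : hom B N) (d : E N A) :
  s d (Seq f g) -> X_monic X f -> is_cokernel (q f) (q g).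
Proof.
move=> sd monf; apply: (epi_triangle_cokernel sd).
exact: X_monic_epi sd monf.
Qed.

Lemma Omega_projective (K : C) : Omega s X K -> projective_obj (o K).
Proof.
move=> [P [Z [k [p [d [sd prP XZ]]]]]] M M'.
have [A oA] := quot_obj hQ M; case: M / oA.
have [B oB] := quot_obj hQ M'; case: M' / oB.
move=> g0 epig u0; have [[g gE] [u ->]] := (quot_full hQ g0, quot_full hQ u0).
rewrite {g0}gE in epig *.
have [B' [N [i [j [g' [h [e [se mong' jg' ji ij]]]]]]]] := cone hS g.
have gE : q g' = q i \oc q g by rewrite -jg' (quotM hQ) compA ij comp1m.
(* In the quotient [h] is an epimorphism, and it is zero because [h \oc i] is killed by the
   epimorphism [q g] and [q i] is invertible. *)
have XN : X N.
  apply: (X_of_quot_id0 hS).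
  apply: (X_monic_epi se mong'); rewrite -(quotM hQ) comp1m comp0m.
  have: q (h \oc i) = 0.
    apply: epig; rewrite comp0m (quotM hQ) -compA -gE -(quotM hQ).
    by rewrite (triangle_comp0 hC se) (quot0 hS).
  rewrite (quotM hQ) => hi; rewrite -[q h]compm1 -ij compA hi.
  exact: comp0m.
(* The obstruction to lifting [i \oc u] along [g'] extends over [P], then lifts along the deflation
   [h] by projectivity. *)
have [t ht] := triangle_X_monic hS sd XZ (h \oc (i \oc u)) XN.
have [t' tE] := prP _ _ _ _ _ _ se t.
(* The correction [t' \oc k] factors through [P], hence is zero in the quotient. *)
have [|w uw] := triangle_ker hC se (f := i \oc u - t' \oc k).
  by rewrite comp_subr ht compA tE subrr.
exists (q w); rewrite -jg' (quotM hQ) -compA -(quotM hQ) -uw (quotB hS).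
rewrite [q (t' \oc k)](quotM hQ) (quot_to_X hS k (eprojective_X hS prP)).
by rewrite compm0 subr0 (quotM hQ) compA ji comp1m.
Qed.

(** A projective presentation of [X1] maps to the [X]-coresolution of [M] over the identity of [X1];
    its component at the first terms is the cover. *)
Lemma Omega_cover (M : C) :
  exists (K : C) (u : hom K M), Omega s X K /\ is_epi (q u).
Proof.
have [X0 [X1 [x [y [d [sd XX0 XX1]]]]]] := X_coresolution hS M.
have [K [P [k [p [e [se prP]]]]]] := tq_proj hS X1.
have [g yg] := prP _ _ _ _ _ _ sd p.
have [|u [eu _]] := extri_ET3_dual hC (b := g) (c := idm X1) se sd.
  by rewrite yg comp1m.
exists K, u; split; first by exists P, X1, k, p, e.
by apply: (triangle_map_epi hS (d' := e) sd XX0 XX1); rewrite eu pull_id.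
Qed.

Lemma Omega_coresolution (K : C) :
  (forall L : C, Sigma s (Omega s X) L -> X L) -> Omega s X K ->
  exists (G J : C) (u : hom K G) (v : hom G J),
    [/\ Sigma s X G, Sigma s X J, is_mono (q u), is_epi (q v)
      & is_cokernel (q u) (q v)].
Proof.
move=> hX OK; have [X1 [X0 [x [y [d [sd XX0 XX1]]]]]] := X_resolution K.
have [J [I [g' [g [d' [/= sd' injI]]]]]] := tq_inj hS X0.
have [G [h [h' [u [v [d'' [_ [sh suv ud _]]]]]]]] := extri_ET4 hC sd sd'.
have [L [I' [j' [j [e [/= se injI']]]]]] := tq_inj hS K.
(* A map from [K] to [X] extends over [I'], because the cosyzygy [L] is in [X]; and [j] extends over
   [G], because [I'] is injective. *)
have monu : X_monic X u.
  move=> Z a XZ; have XL : X L by apply: hX; exists I', K, j', j, e.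
  have [b ->] := triangle_X_monic hS se XL a XZ.
  have [w /= <-] := injI' _ _ _ _ _ _ suv j.
  by exists (b \oc w); rewrite compA.
have epiv := X_monic_epi suv monu.
exists G, J, u, v; split=> //.
- by exists I, X1, h', h, d''.
- by exists I, X0, g', g, d'.
- exact: triangle_map_mono sd XX0 XX1 ud.
- exact: epi_triangle_cokernel suv epiv.
Qed.

Lemma quot_cokernel (A B : C) (f : hom A B) :
  exists (N : C) (g : hom B N), is_cokernel (q f) (q g).
Proof.
have [B' [N [i [p [f' [g [d [sd monf pf pi ip]]]]]]]] := cone hS f.
have qf : q f' = q i \oc q f by rewrite -pf (quotM hQ) compA ip comp1m.
exists N, (g \oc i).
have [gf gP] := X_monic_cokernel sd monf.
rewrite (quotM hQ); split=> [|W w wf]; first by rewrite -compA -qf.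
have [|t [tg tP]] := gP W (w \oc q p).
  by rewrite qf compA -(compA w) pi compm1.
exists t; split=> [|t' t'g]; first by rewrite compA tg -compA pi compm1.
by apply: tP; rewrite -t'g -!compA ip compm1.
Qed.

Lemma quot_normal_mono (A B : C) (f : hom A B) :
  is_mono (q f) -> exists (N : C) (g : hom B N), is_kernel (q g) (q f).
Proof.
have [B' [N [i [p [f' [g [d [sd _ pf pi ip]]]]]]]] := cone hS f.
have qf : q f' = q i \oc q f by rewrite -pf (quotM hQ) compA ip comp1m.
move=> monof; exists N, (g \oc i).
have [|gf gP] := mono_triangle_kernel hS sd.
  move=> W a b; rewrite qf -!compA => /(congr1 (comp (q p))).
  by rewrite !compA pi !comp1m => /monof.
rewrite (quotM hQ); split=> [|W w gw]; first by rewrite -compA -qf.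
have [|t [tf tP]] := gP W (q i \oc w); first by rewrite compA.
exists t; split=> [|t' t'f].
  by rewrite -[q f]comp1m -pi -(compA (q p)) -qf -compA tf compA pi comp1m.
by apply: tP; rewrite qf -compA t'f.
Qed.

Lemma quot_additive : is_additive Q.
Proof.
have [[Z [Z1 Z2]] bipC] := extri_additive hC; split.
  exists (o Z); split=> M; have [A oA] := quot_obj hQ M; case: M / oA => u;
  have [f ->] := quot_full hQ u.
    by rewrite (Z1 _ f) (quot0 hS).
  by rewrite (Z2 _ f) (quot0 hS).
move=> M M'; have [A oA] := quot_obj hQ M; case: M / oA.
have [B oB] := quot_obj hQ M'; case: M' / oB.
have [S] := bipC A B; exists.
exists (o S) (q (in1 S)) (q (in2 S)) (q (pr1 S)) (q (pr2 S)).
- by rewrite -(quotM hQ) pr1in1 (quot1 hQ).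
- by rewrite -(quotM hQ) pr2in2 (quot1 hQ).
- by rewrite -(quotM hQ) pr1in2 (quot0 hS).
- by rewrite -(quotM hQ) pr2in1 (quot0 hS).
- by rewrite -!(quotM hQ) -(quotD hQ) bip_sum (quot1 hQ).
Qed.

Lemma quot_enough_projectives : enough_projectives Q.
Proof.
move=> M; have [A oA] := quot_obj hQ M; case: M / oA.
have [K [u [OK epiu]]] := Omega_cover A.
by exists (o K), (q u); split=> //; exact: Omega_projective.
Qed.

Lemma quot_cokernels (A B : Q) (f : hom A B) :
  exists (N : Q) (g : hom B N), is_cokernel f g.
Proof.
have [A' oA] := quot_obj hQ A; case: A / oA f.
have [B' oB] := quot_obj hQ B; case: B / oB => f0.
have [f ->] := quot_full hQ f0; have [N [g fg]] := quot_cokernel f.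
by exists (o N), (q g).
Qed.

Lemma quot_normal (A B : Q) (f : hom A B) : is_mono f ->
  exists (N : Q) (g : hom B N), is_kernel g f.
Proof.
have [A' oA] := quot_obj hQ A; case: A / oA f.
have [B' oB] := quot_obj hQ B; case: B / oB => f0.
have [f ->] := quot_full hQ f0 => /quot_normal_mono[N [g fg]].
by exists (o N), (q g).
Qed.

End AbelianQuotient.

(** * Projective dimension at most one *)

Section ProjectiveDimension.
Variable Q : preadditive.

(* The comparison maps between the two presentations compose to the identity of
   [R] up to a homotopy [h], which exhibits [R] as a retract of P1 + Q0. *)
Lemma retract_kernel_projective (M J P0 P1 Q0 R : Q)
    (i : hom M J) (r : hom J M) (e : hom P0 J) (k : hom P1 P0)
    (f : hom Q0 M) (l : hom R Q0) :
  r \oc i = idm M -> is_epi e -> is_kernel e k -> is_epi f -> is_kernel f l ->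
  projective_obj P0 -> projective_obj P1 -> projective_obj Q0 ->
  projective_obj R.
Proof.
move=> ri epie [ek kP] epif [fl lP] prP0 prP1 prQ0 A B p epip phi.
have [i0 i0E] := prQ0 _ _ e epie (i \oc f).
have [r0 r0E] := prP0 _ _ f epif (r \oc e).
have [|i1 [i1E _]] := kP _ (i0 \oc l).
  by rewrite compA i0E -compA fl compm0.
have [|r1 [r1E _]] := lP _ (r0 \oc k).
  by rewrite compA r0E -compA ek compm0.
have [|h [hE _]] := lP _ (r0 \oc i0 - idm Q0).
  by rewrite comp_subr compA r0E -compA i0E compA ri comp1m compm1 subrr.
have hl : r1 \oc i1 - idm R = h \oc l.
  have [|z [_ zP]] := lP _ (l \oc (h \oc l)); first by rewrite compA fl comp0m.
  rewrite -(zP (h \oc l)) // -(zP (r1 \oc i1 - idm R)) //.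
  rewrite comp_subr compA r1E -compA i1E compA compm1.
  by rewrite compA hE comp_subl comp1m.
have [a aE] := prP1 _ _ p epip (phi \oc r1).
have [b bE] := prQ0 _ _ p epip (phi \oc h).
exists (a \oc i1 - b \oc l); rewrite comp_subr !compA aE bE -!compA -hl.
by rewrite -comp_subr opprB addrC subrK compm1.
Qed.

Lemma pd_le1 (M P0 P1 : Q) (e : hom P0 M) (k : hom P1 P0) :
  (exists Z : Q, is_zero_obj Z) -> is_epi e -> is_kernel e k ->
  projective_obj P0 -> projective_obj P1 -> pd_le M 1.
Proof.
move=> [Z [Z1 Z2]] epie [ek kP] prP0 prP1.
(* The two-term resolution is padded by a zero object from degree two on. *)
pose P n : Q := if n is n'.+1 then if n' is _.+1 then Z else P1 else P0.
pose d n : hom (P n.+1) (P n) :=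
  match n return hom (P n.+1) (P n) with 0%N => k | _ => 0 end.
exists P, d, e; split=> //.
- case=> [//|[//|n]] A B p epip f; exists 0; by rewrite compm0 [RHS]Z2.
- exists P1, k, (idm P1); split; [by []|by rewrite compm1|].
  by move=> W u v; rewrite !compm1.
- case=> [|n]; exists Z, 0, 0; split; rewrite ?compm0 //.
  (* Exactness at [P1] amounts to [k] being a monomorphism, which is the uniqueness part of its
     kernel property. *)
  + split=> [|W g kg]; first by rewrite compm0.
    exists 0; split=> [|z _]; last by rewrite [RHS]Z1.
    have [|w [_ wP]] := kP W (k \oc g); first by rewrite compA ek comp0m.
    by rewrite -(wP g) // -(wP (0 \oc 0)) // compm0 kg compm0.
  + by move=> W u v _; rewrite [LHS]Z2 [RHS]Z2.
  + split=> [|W g _]; first by rewrite compm0.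
    exists 0; split=> [|z _]; last by rewrite [RHS]Z1.
    by rewrite compm0 [RHS]Z1.
  + by move=> W u v _; rewrite [LHS]Z2 [RHS]Z2.
- by case=> [//|[//|n]].
Qed.

(** Any projective presentation of the retract [M] has projective kernel, by comparison with the
    resolution of [J]. *)
Lemma retract_pd_le1 (M J P0 P1 : Q) (i : hom M J) (r : hom J M)
    (e : hom P0 J) (k : hom P1 P0) :
  (exists Z : Q, is_zero_obj Z) -> enough_projectives Q ->
  (forall (A B : Q) (f : hom A B),
     exists (K : Q) (k : hom K A), is_kernel f k) ->
  r \oc i = idm M -> is_epi e -> is_kernel e k ->
  projective_obj P0 -> projective_obj P1 -> pd_le M 1.
Proof.
move=> exZ enP kerQ ri epie ke prP0 prP1; have [Q0 [f [prQ0 epif]]] := enP M.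
have [R [l lf]] := kerQ _ _ f; apply: (pd_le1 exZ epif lf) => //.
exact: (retract_kernel_projective ri epie ke epif lf).
Qed.

End ProjectiveDimension.

(** The embedding of [I] into an object of [Sigma X] splits, and that object has a two-term
    resolution by objects of [Omega X], by the dual of [Omega_coresolution]. *)
Lemma injective_pd_le1 (C : preadditive) (E : biadditive_functor C)
    (s : correspondence E) (X : C -> Prop) (Q : preadditive) (o : C -> Q)
    (q : forall A B : C, hom A B -> hom (o A) (o B)) :
  tilting_quotient s X q -> (forall K : C, Omega s (Sigma s X) K -> X K) ->
  forall I : Q, injective_obj I -> pd_le I 1.
Proof.
move=> hS hX I injI; have hQ := tq_quot hS; have hSop := op_tilting_quotient hS.
have [M oM] := quot_obj hQ I; case: I / oM injI => injM.
have [J [r [SJ monr]]] := Omega_cover hSop M.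
have [t tr] := injM _ _ _ monr (idm (o M)).
have [|P0 [P1 [e [k [OP0 OP1 epie _ ke]]]]] := Omega_coresolution hSop _ SJ.
  (* Passing to the opposite twice restores objects, morphisms and extensions, so the two conditions
     agree by unfolding. *)
  by move=> L OL; apply: hX; exact: OL.
have [exZ _] := quot_additive hS.
apply: (@retract_pd_le1 _ (o M) (o J) (o P0) (o P1)
  (q _ _ r) t (q _ _ e) (q _ _ k)) => //.
- exact: (quot_enough_projectives hS).
- by move=> A B f; exact: (quot_cokernels hSop f).
- by apply: (Omega_projective hS); exact: OP0.
by apply: (Omega_projective hS); exact: OP1.
Qed.

(** * Abelianness and the Gorenstein bound *)

Lemma quot_abelian (C : preadditive) (E : biadditive_functor C)
    (s : correspondence E) (X : C -> Prop) (Q : preadditive) (o : C -> Q)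
    (q : forall A B : C, hom A B -> hom (o A) (o B)) :
  tilting_quotient s X q -> is_abelian Q.
Proof.
move=> hS; have hSop := op_tilting_quotient hS; split.
- exact: quot_additive hS.
- by move=> A B f; exact: (quot_cokernels hSop (f : @hom (op Q) B A)).
- exact: (quot_cokernels hS).
- exact: (quot_normal hS).
- by move=> A B f; exact: (@quot_normal _ _ _ _ _ _ _ hSop B A f).
Qed.

Theorem theorem1p2 (C : preadditive) (E : biadditive_functor C)
    (s : correspondence E) (hC : extriangulated s)
    (hP : enough_eprojectives s) (hI : enough_einjectives s)
    (X : C -> Prop) (hX : cluster_tilting E X) :
  let A := quotient_cat (factor_ideal (extri_additive hC) hX) in
  is_abelian A /\
  (enough_projectives A /\ enough_injectives A) /\
  ((forall K : C, Sigma s (Omega s X) K -> X K) ->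
   (forall K : C, Omega s (Sigma s X) K -> X K) ->
   gorenstein A /\ gorenstein_dim_le A 1).
Proof.
set J := factor_ideal _ _ => Q.
have hS : @tilting_quotient C E s X Q (fun A => A) (fun A B => @qpi C J A B).
  split=> //; split.
  - by move=> M; exists M.
  - by move=> A B f g; exact: qpiD.
  - by [].
  - by move=> A B D g f; rewrite [RHS]qcomp_pi.
  - by move=> A B u; exists (qrepr u); rewrite qreprK.
  move=> A B f; have <- : qpi J (0 : hom A B) = 0.
    by apply: (addIr (qpi J 0)); rewrite -qpiD addr0 add0r.
  by rewrite qpiP subr0.
have hSop := op_tilting_quotient hS.
split; first exact: quot_abelian hS.
split.
  split; first exact: quot_enough_projectives hS.
  exact: quot_enough_projectives hSop.
move=> SO OS; suff [idP pdI] : gorenstein_dim_le Q 1.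
  by split=> //; split=> M prM; exists 1%N; [exact: idP|exact: pdI].
split; last exact: injective_pd_le1 hS OS.
(* A projective object is an injective object of the opposite category, where the two inclusions are
   exchanged. *)
move=> P prP; apply: (injective_pd_le1 hSop) => [K OK|]; last exact: prP.
by apply: SO; exact: OK.
Qed.
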